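(* If $X$ is a regular OHD space with at least two points, then $\mathscr{F}[X]$ is WSHD.
   Context: Regular spaces are understood to be $T_1$ (as in Engelking's book). The Pixley-Roy hyperspace $\mathscr{F}[X]$ is the set of all non-empty finite subsets of $X$ with the topology having as a base all sets $[F,U]=\{G\in\mathscr{F}[X] : F\subseteq G\subseteq U\}$, where $F\in\mathscr{F}[X]$ and $U\subseteq X$ is open. Let $Y$ be a topological space. A sequence $(U_n)_{n\in\omega}$ of non-empty open subsets of $Y$ converges to $y\in Y$ if for every open $U\ni y$ there is $m\in\omega$ with $U_n\subseteq U$ for all $n\geq m$. $Y$ is OHD (openly highly divergent) if no sequence of non-empty open subsets of $Y$ converges to a point of $Y$. $Y$ is WSHD (weakly selectively highly divergent) if for every sequence $(U_n)_{n\in\omega}$ of non-empty open subsets of $Y$ there are an infinite $A\subseteq\omega$ and points $x_n\in U_n$ for $n\in A$ such that the sequence $(x_n)_{n\in A}$ has no convergent subsequence. *)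

(* Defs.v *)
From HB Require Import structures.
From mathcomp Require Import all_boot finmap.
From mathcomp Require Import boolp classical_sets cardinality topology.

Set Implicit Arguments.
Unset Strict Implicit.
Unset Printing Implicit Defensive.

Local Open Scope classical_set_scope.

Definition pixley_roy (X : topologicalType) : Type :=
  {F : {fset X} | F != fset0%fset}.

HB.instance Definition _ (X : topologicalType) :=
  Choice.copy (pixley_roy X) {F : {fset X} | F != fset0%fset}.

Definition pixley_roy_set (X : topologicalType) (F : pixley_roy X) : set X :=
  [set` val F].

Definition pixley_roy_box (X : topologicalType) (F : pixley_roy X)
    (U : set X) : set (pixley_roy X) :=
  [set G | pixley_roy_set F `<=` pixley_roy_set G /\ pixley_roy_set G `<=` U].

Definition pixley_roy_base (X : topologicalType) : set (set (pixley_roy X)) :=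
  [set B | exists F U, open U /\ B = pixley_roy_box F U].

Lemma pixley_roy_base_cover (X : topologicalType) :
  \bigcup_(B in @pixley_roy_base X) B = setT.
Proof.
apply/seteqP; split=> // F _; exists (pixley_roy_box F setT).
  by exists F, setT; split=> //; exact: openT.
by split.
Qed.

Lemma pixley_roy_base_join (X : topologicalType)
    (B C : set (pixley_roy X)) (F : pixley_roy X) :
  pixley_roy_base B -> pixley_roy_base C -> B F -> C F ->
  exists D, [/\ pixley_roy_base D, D F & D `<=` B `&` C].
Proof.
move=> [G [U [oU ->]]] [H [V [oV ->]]] [GF FU] [HF FV].
exists (pixley_roy_box F (U `&` V)); split.
- by exists F, (U `&` V); split=> //; exact: openI.
- by split=> // x Fx; split; [exact: FU | exact: FV].
- move=> K [FK KUV]; split; split.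
  + exact: subset_trans FK.
  + by move=> x /KUV[].
  + exact: subset_trans FK.
  + by move=> x /KUV[].
Qed.

HB.instance Definition _ (X : topologicalType) :=
  isBaseTopological.Build (pixley_roy X)
    (@pixley_roy_base_cover X) (@pixley_roy_base_join X).

Lemma pixley_roy_basis (X : topologicalType) : basis (@pixley_roy_base X).
Proof.
split=> [B bB|F A].
  by exists [set B]; [move=> _ ->|rewrite bigcup_set1].
rewrite nbhsE => -[_ [[D sD <-] [B DB BF]] sBA].
exists B; first by split=> //; exact: sD.
by move=> G BG; apply: sBA; exists B.
Qed.

Definition open_seq_cvg (Y : topologicalType) (U : nat -> set Y) (y : Y) :=
  forall V : set Y, open V -> V y ->
    exists m : nat, forall n : nat, (m <= n)%N -> U n `<=` V.

Definition OHD (Y : topologicalType) :=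
  forall U : nat -> set Y, (forall n, open (U n) /\ U n !=set0) ->
    forall y : Y, ~ open_seq_cvg U y.

(* The family (x_n)_{n in A} is the restriction to A of a total x : nat -> Y,
   whose values outside A are irrelevant; its subsequences are the x \o k with
   k strictly increasing and valued in A. *)
Definition WSHD (Y : topologicalType) :=
  forall U : nat -> set Y, (forall n, open (U n) /\ U n !=set0) ->
    exists (A : set nat) (x : nat -> Y),
      [/\ infinite_set A,
          (forall n, A n -> U n (x n)) &
          forall k : nat -> nat,
            {homo k : m n / (m < n)%N} -> (forall j, A (k j)) ->
            ~ exists y : Y, x \o k @ \oo --> y].

(* Main.v *)
(** Refine the given sequence to boxes [F n, V n].  If (F n) has no convergent
    subsequence, take the points F n.  Otherwise F n -> G along a subsequence.
    Fix p in G.  Since the V n do not converge to p, regularity gives an open U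
    containing G such that V n \ U has non-empty interior for infinitely many
    such n.  These interiors are infinite, as an OHD T1 space has no isolated
    point, so there are pairwise distinct points z n in V n \ U.  The points
    {z n} + F n then have no convergent subsequence: since each z n occurs only
    once, a limit H would be contained in G, hence in U, which forces z n in U
    eventually. *)
Require Import Defs.
From mathcomp Require Import all_boot boolp classical_sets topology.
From mathcomp Require Import finmap cardinality.

Local Open Scope classical_set_scope.

Lemma infinite_set_unbounded (A : set nat) :
  (forall N, exists2 n, (N <= n)%N & A n) -> infinite_set A.
Proof.
move=> Aub /finite_fsetP[B AB].
have [n nB] := Aub (\max_(i <- enum_fset B) i).+1.
by rewrite AB => nB'; move: nB; rewrite ltnNge (@leq_bigmax_seq _ _ _ id).
Qed.

(** Greedy recursion: an infinite set is not exhausted by the finite list [L n] of the values picked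
    before stage [n]. *)
Lemma injective_choice (T : choiceType) (D : nat -> set T) :
  (forall n, infinite_set (D n)) ->
  exists z : nat -> T, injective z /\ forall n, D n (z n).
Proof.
move=> Dinf.
have fresh (ns : nat * seq T) : exists x, D ns.1 x /\ x \notin ns.2.
  case: ns => n s; apply: contrapT => /forallNP DsN; apply: (Dinf n).
  apply: (sub_finite_set _ (finite_seq s)) => x Dx /=.
  by apply: contrapT => /negP xs; apply: (DsN x).
have [f fP] := choice fresh.
pose L := fix L n := if n is m.+1 then f (m, L m) :: L m else [::].
have zL m n : (m < n)%N -> f (m, L m) \in L n.
  elim: n => // n IH; rewrite ltnS leq_eqVlt inE => /orP[/eqP->|/IH ->].
    by rewrite eqxx.
  by rewrite orbT.
have zlt m n : (m < n)%N -> f (m, L m) <> f (n, L n).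
  by move=> /zL mL mn; have [_ /negP] := fP (n, L n); rewrite -mn.
exists (fun n => f (n, L n)); split=> [m n mn|n]; last by have [] := fP (n, L n).
by case: (ltngtP m n) => // [/zlt/(_ mn)//|/zlt nm]; case: nm.
Qed.

Lemma regular_open_nbhs (X : topologicalType) (p : X) (O : set X) :
  @regular_space X -> open O -> O p ->
  exists W, [/\ open W, W p & closure W `<=` O].
Proof.
move=> Xreg oO Op.
have [B /nbhs_interior Bp BO] := Xreg p O (open_nbhs_nbhs (conj oO Op)).
exists B°; split; [exact: open_interior|exact: nbhs_singleton|].
exact: subset_trans (closure_subset (@interior_subset _ B)) BO.
Qed.

(** In a T1 space every point of a finite open set is isolated, and for an isolated [x] the constant
    sequence [[set x]] converges to [x]. *)
Lemma OHD_open_infinite (X : topologicalType) (D : set X) :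
  accessible_space X -> OHD X -> open D -> D !=set0 -> infinite_set D.
Proof.
move=> XT1 Xohd oD [x Dx] Dfin.
have ox : open [set x].
  have -> : [set x] = D `&` ~` (D `\ x).
    apply/seteqP; split=> [_ ->|y [Dy DyN]]; first by split=> // -[_]; exact.
    by apply: contrapT => yx; apply: DyN.
  apply: openI => //; apply: closed_openC.
  by apply: (iffLR accessible_finite_set_closed XT1); exact: finite_setD.
apply: (Xohd (fun=> [set x]) _ x) => [_|V _ Vx]; first by split=> //; exists x.
by exists 0%N => n _ _ ->.
Qed.

Lemma OHD_separating_open (X : topologicalType) (F : set X) (p : X)
    (V : nat -> set X) :
  accessible_space X -> @regular_space X -> OHD X ->
  finite_set F -> F p -> (forall n, open (V n) /\ V n p) ->
  exists U, [/\ open U, F `<=` U &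
    forall m, exists2 n, (m <= n)%N & (V n `\` U)° !=set0].
Proof.
move=> XT1 Xreg Xohd Ffin Fp VP.
have oF : open (~` (F `\ p)).
  apply: closed_openC.
  by apply: (iffLR accessible_finite_set_closed XT1); exact: finite_setD.
(* OHD is applied at [p] inside [W], away from the other points of [F]. *)
have [W [oW Wp WF]] : exists W, [/\ open W, W p & closure W `<=` ~` (F `\ p)].
  by apply: regular_open_nbhs => // -[_]; exact.
have /existsNP[O /not_implyP[oO /not_implyP[Op /forallNP VO]]] :
    ~ open_seq_cvg (fun n => V n `&` W) p.
  apply: Xohd => n; have [oV Vp] := VP n.
  by split; [exact: openI|exists p].
have [O' [oO' O'p O'O]] := regular_open_nbhs _ _ _ Xreg oO Op.
(* [O'] catches [p] and the exterior of [W] catches the rest of [F]. The open set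
   [(V n]&[W)]\[closure O'] avoids both pieces, and it contains any point of [V n]&[W] outside [O],
   since [closure O'] lies in [O]. *)
exists (O' `|` ~` closure W); split.
- by apply: openU => //; apply: closed_openC; exact: closed_closure.
- move=> x Fx; have [->|xp] := pselect (x = p); first by left.
  by right=> /WF; apply.
- move=> m; have /existsNP[n /not_implyP[mn /existsNP[x]]] := VO m.
  move=> /not_implyP[[Vx Wx] Ox]; exists n => //; exists x.
  rewrite /interior nbhsE; exists ((V n `&` W) `\` closure O').
    split; last by split=> // /O'O.
    apply: openI; last by apply: closed_openC; exact: closed_closure.
    by apply: openI => //; case: (VP n).
  move=> y [[Vy Wy] O'y]; split=> // -[|].
    by move=> /subset_closure.
  by apply; exact: subset_closure.
Qed.

Lemma pixley_roy_cvg_box (X : topologicalType) (y : nat -> pixley_roy X)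
    (G : pixley_roy X) (U : set X) :
  y @ \oo --> G -> open U -> pixley_roy_set G `<=` U ->
  exists m, forall n, (m <= n)%N -> pixley_roy_box G U (y n).
Proof.
move=> yG oU GU.
have [m _ mP] : nbhs \oo (y @^-1` pixley_roy_box G U).
  apply: yG; apply: open_nbhs_nbhs; split; last by split.
  by apply: (pixley_roy_basis X).1; exists G, U.
by exists m => n mn; exact: mP.
Qed.

Lemma pixley_roy_cvg_notin (X : topologicalType) (y : nat -> pixley_roy X)
    (G : pixley_roy X) (x : X) :
  accessible_space X -> y @ \oo --> G -> ~ pixley_roy_set G x ->
  exists m, forall n, (m <= n)%N -> ~ pixley_roy_set (y n) x.
Proof.
move=> XT1 yG Gx.
have [|z Gz zx|m mP] := pixley_roy_cvg_box _ _ _ (~` [set x]) yG.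
- by apply: closed_openC; exact: accessible_closed_set1.
- by apply: Gx; rewrite -zx.
- by exists m => n /mP[_ yx] /yx; apply.
Qed.

Lemma pixley_roy_open_box (X : topologicalType) (U : set (pixley_roy X)) :
  open U -> U !=set0 -> exists FV : pixley_roy X * set X,
    [/\ open FV.2, pixley_roy_set FV.1 `<=` FV.2 &
        pixley_roy_box FV.1 FV.2 `<=` U].
Proof.
move=> oU [G UG].
have [_ [[F [V [oV ->]]] [FG GV]] FVU] :=
  (pixley_roy_basis X).2 G U (open_nbhs_nbhs (conj oU UG)).
by exists (F, V); split=> //; exact: subset_trans GV.
Qed.

Definition pixley_roy_add (X : topologicalType) (x : X) (F : pixley_roy X) :
    pixley_roy X :=
  exist _ (x |` val F)%fset (introT (fset0Pn _) (ex_intro _ x (fset1U1 x (val F)))).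

Lemma pixley_roy_addE (X : topologicalType) (x : X) (F : pixley_roy X) :
  pixley_roy_set (pixley_roy_add X x F) = x |` pixley_roy_set F.
Proof.
apply/seteqP; split=> y; rewrite /pixley_roy_set /= in_fset1U.
  by case/orP=> [/eqP|]; [left|right].
by case=> [->|->]; rewrite ?eqxx ?orbT.
Qed.

Theorem theorem10 (X : topologicalType)
    (X_T1 : accessible_space X) (X_regular : @regular_space X)
    (X_OHD : OHD X) (X_two_points : exists x y : X, x <> y) :
  WSHD (pixley_roy X).
Proof.
move=> B BP.
have [f fP] := choice (fun n => pixley_roy_open_box X _ (BP n).1 (BP n).2).
pose F n : pixley_roy X := (f n).1; pose V n := (f n).2.
have oV n : open (V n) by case: (fP n).
have FV n : pixley_roy_set (F n) `<=` V n by case: (fP n).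
have boxB n : pixley_roy_box (F n) (V n) `<=` B n by case: (fP n).
have [[k [kmono [G FG]]]|Fdiv] := pselect
    (exists k : nat -> nat, {homo k : m n / (m < n)%N} /\
       exists G : pixley_roy X, F \o k @ \oo --> G); last first.
  exists setT, F; split=> [||k kmono _ FG]; first exact: infinite_nat.
    by move=> n _; apply: boxB; split=> //; exact: FV.
  by apply: Fdiv; exists k.
(* Only the lower half of the box matters here: from [m0] on, [G] is contained in [F (k n)], so [p]
   lies in [V (k n)]. *)
have [m0 m0P] : exists m, forall n, (m <= n)%N ->
    pixley_roy_box G setT (F (k n)).
  exact: (pixley_roy_cvg_box _ _ _ _ FG openT).
have [p Gp] : exists p, pixley_roy_set G p by apply/fset0Pn: (valP G).
have kge l (lmono : {homo l : m n / (m < n)%N}) n : (n <= l n)%N.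
  by elim: n => // n IH; apply: leq_ltn_trans IH (lmono _ _ _).
have [U [oU GU Uub]] : exists U, [/\ open U, pixley_roy_set G `<=` U &
    forall m, exists2 n, (m <= n)%N & (V (k (m0 + n)) `\` U)° !=set0].
  apply: (OHD_separating_open _ _ p) => //; first exact: finite_fset.
  by move=> n; split=> //; apply: FV; apply: (m0P _ (leq_addr _ _)).1.
pose A := [set k i | i in [set i | (V (k i) `\` U)° !=set0]].
(* Outside [A] the value [setT] is a dummy: it is infinite too, so [z] can be chosen injective on
   all of [nat]. *)
pose D n := if pselect (A n) then (V n `\` U)° else setT.
have [z [zinj zD]] : exists z : nat -> X, injective z /\ forall n, D n (z n).
  apply: injective_choice => n; rewrite /D; case: pselect => [An|_] /=.
    by apply: OHD_open_infinite => //;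
      [exact: open_interior|case: An => i Vi <-].
  by apply: OHD_open_infinite => //; [exact: openT|exists p].
have zVU n : A n -> (V n `\` U) (z n).
  move=> An; apply: interior_subset; move: (zD n); rewrite /D.
  by case: pselect.
exists A, (fun n => pixley_roy_add X (z n) (F n)); split.
- apply: infinite_set_unbounded => N; have [n Nn Vn] := Uub N.
  exists (k (m0 + n)%N); last by exists (m0 + n)%N.
  exact: leq_trans (leq_trans Nn (leq_addl _ _)) (kge _ kmono _).
- move=> n /zVU[Vz _]; apply: boxB; rewrite /pixley_roy_box /= pixley_roy_addE.
  by split=> [x Fx|x [->|/FV]] //; right.
- move=> l lmono lA [H HP].
  have HG : pixley_roy_set H `<=` pixley_roy_set G.
    move=> x Hx; apply: contrapT => Gx.
    have [m mP] := pixley_roy_cvg_notin _ _ _ _ X_T1 FG Gx.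
    have [m' m'P] := pixley_roy_cvg_box _ _ _ _ HP openT (@subsetT _ _).
    (* The bound [m'] puts [x] in the term at [l j]. Writing [l j = k i], the bound
       [k m <= j <= l j] forces [m <= i], so [x] is not in [F (l j)] and must be the added point. *)
    have xz j : (maxn (k m) m' <= j)%N -> x = z (l j).
      rewrite geq_max => /andP[kmj /m'P[/(_ x Hx)]].
      rewrite /= pixley_roy_addE => -[//|Fx _]; exfalso.
      have [i _ kil] := lA j; apply: (mP i); last by rewrite /= kil.
      rewrite leqNgt; apply/negP => /kmono; rewrite kil ltnNge.
      by rewrite (leq_trans kmj) // kge.
    (* Two consecutive indices would share the added point [x], against injectivity of [z] and
       strict growth of [l]. *)
    have /zinj lE := etrans (esym (xz _ (leqnn _))) (xz _ (leqnSn _)).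
    by have := lmono _ _ (ltnSn (maxn (k m) m')); rewrite -lE ltnn.
  have [m mP] := pixley_roy_cvg_box _ _ _ _ HP oU (subset_trans HG GU).
  have [_ /(_ (z (l m)))] := mP m (leqnn m).
  by rewrite /= pixley_roy_addE => /(_ (or_introl erefl)); case: (zVU _ (lA m)).
Qed.
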